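(* Let $d\in(0,\frac12)$ and let $L^d=(L^d_t)_{t\in\mathbb{R}}$ be a fractional L\'evy process. Then for every $\alpha>d+\frac12$, $$\lim_{t\to-\infty}\frac{|L^d_t|}{|t|^\alpha}=0\qquad\text{almost surely.}$$
   Context: All random objects live on a complete probability space $(\Omega,\mathcal F,P)$. A two-sided L\'evy process is $L_t=L^1_t1_{\{t\ge0\}}+L^2_{-t-}1_{\{t<0\}}$, $t\in\mathbb R$, where $L^1,L^2$ are two independent copies of the same L\'evy process. Fractional L\'evy process (FLP): let $L=(L_t)_{t\in\mathbb R}$ be a zero-mean two-sided L\'evy process with $E[L(1)^2]<\infty$ and without Brownian component, and $d\in(0,\frac12)$; the FLP with driving L\'evy process $L$ is $$L^d_t:=\frac{1}{\Gamma(d+1)}\int_{-\infty}^\infty[(t-s)_+^d-(-s)_+^d]\,L(ds),\quad t\in\mathbb R,$$ where the integral exists in the $L^2(\Omega)$-sense. One always works with the modification given by the pathwise improper Riemann integral $$L^d_t=\frac{1}{\Gamma(d)}\int_{\mathbb R}[(t-s)_+^{d-1}-(-s)_+^{d-1}]\,L(s)\,ds,\quad t\in\mathbb R,$$ which is continuous in $t$. *)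

(* Defs.v *)
From HB Require Import structures.
From mathcomp Require Import all_boot all_order all_algebra.
From mathcomp Require Import all_classical all_reals all_analysis.

Import Order.TTheory GRing.Theory Num.Def Num.Theory.
Import numFieldNormedType.Exports.

Local Open Scope classical_set_scope.
Local Open Scope ring_scope.

Section Calculus.
Context {R : realType}.
Implicit Types (f : R -> R) (a b v x p : R).

Definition Gamma x : R :=
  \int[lebesgue_measure]_(s in `]0, +oo[) (s `^ (x - 1) * expR (- s)).

(* x_+ ^ p.  Since 0 `^ p = 0 for p != 0, this vanishes for all x <= 0, also
   when p is negative. *)
Definition pos_powR x p : R := maxr x 0 `^ p.

(* v is the (proper) Riemann integral of f over [a, b], as the limit of the
   Riemann sums over the tagged partitions (x, xi) when the mesh goes to 0. *)
Definition is_Riemann_integral f a b v : Prop :=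
  a <= b /\
  forall e : R, 0 < e -> exists2 delta, 0 < delta &
    forall (n : nat) (x xi : nat -> R), x 0%N = a -> x n = b ->
      (forall i, (i < n)%N ->
         x i <= xi i <= x i.+1 /\ x i.+1 - x i < delta) ->
      `|\sum_(i < n) f (xi i) * (x i.+1 - x i) - v| < e.

(* The lower endpoint tends to its limit along F and, independently, the upper
   one along G. *)
Definition is_improper_Riemann_integral f (F G : set_system R) v : Prop :=
  forall e : R, 0 < e -> \forall x \near F & y \near G,
    exists2 I, is_Riemann_integral f x y I & `|I - v| < e.

(* Improper Riemann integral from the end F to +oo of a function with
   singularities at the points of ps, which must be listed in increasing
   order: it is the sum of the improper integrals over the open intervals
   delimited by these points. *)
Fixpoint is_improper_Riemann_integral_upto_pinfty
    f (F : set_system R) (ps : seq R) v : Prop :=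
  if ps is p :: ps' then
    exists v1 v2, [/\ is_improper_Riemann_integral f F p^'- v1,
      is_improper_Riemann_integral_upto_pinfty f p^'+ ps' v2 & v = v1 + v2]
  else is_improper_Riemann_integral f F +oo v.

Definition is_improper_Riemann_integral_line f (ps : seq R) v : Prop :=
  is_improper_Riemann_integral_upto_pinfty f -oo ps v.

End Calculus.

Section LevyProcesses.
Context {disp : measure_display} {T : measurableType disp} {R : realType}.
Variable P : probability T R.

Definition mutually_independent {n : nat} (Y : 'I_n -> T -> R) : Prop :=
  forall B : 'I_n -> set R, (forall i, measurable (B i)) ->
    P [set w | forall i, B i (Y i w)] = (\prod_(i < n) P (Y i @^-1` B i))%E.

(* One-sided processes are only considered at times t >= 0; the values at
   t < 0 of the family X : R -> {RV P >-> R} are irrelevant. *)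

Definition independent_increments (X : R -> {RV P >-> R}) : Prop :=
  forall (n : nat) (t : nat -> R), 0 <= t 0%N ->
    (forall i, (i < n)%N -> t i <= t i.+1) ->
    mutually_independent (fun (i : 'I_n) w => X (t i.+1) w - X (t i) w).

Definition stationary_increments (X : R -> {RV P >-> R}) : Prop :=
  forall s t : R, 0 <= s -> 0 <= t -> forall B : set R, measurable B ->
    P [set w | B (X (s + t) w - X s w)] = P [set w | B (X t w - X 0 w)].

Definition stochastically_continuous (X : R -> {RV P >-> R}) : Prop :=
  forall t e : R, 0 <= t -> 0 < e ->
    P [set w | e < `|X s w - X t w|]
      @[s --> within [set s | 0 <= s] (nbhs t)] --> 0%E.

Definition cadlag (x : R -> R) : Prop :=
  (forall t : R, 0 <= t -> x s @[s --> t^'+] --> x t) /\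
  (forall t : R, 0 < t -> cvg (x s @[s --> t^'-])).

Definition levy_process (X : R -> {RV P >-> R}) : Prop :=
  [/\ {ae P, forall w, X 0 w = 0},
      independent_increments X,
      stationary_increments X,
      stochastically_continuous X
    & {ae P, forall w, cadlag (fun t => X t w)}].

Definition same_law (X Y : R -> {RV P >-> R}) : Prop :=
  forall (n : nat) (t : 'I_n -> R) (B : 'I_n -> set R),
    (forall i, 0 <= t i) -> (forall i, measurable (B i)) ->
    P [set w | forall i, B i (X (t i) w)] =
    P [set w | forall i, B i (Y (t i) w)].

Definition process_sigma_algebra (X : R -> {RV P >-> R}) : set (set T) :=
  <<s [set A | exists (t : R) (B : set R),
                 [/\ 0 <= t, measurable B & A = X t @^-1` B]] >>.

Definition independent_processes (X Y : R -> {RV P >-> R}) : Prop :=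
  forall A B, process_sigma_algebra X A -> process_sigma_algebra Y B ->
    P (A `&` B) = (P A * P B)%E.

(* For t < 0 the value is the left limit of L2 at - t. *)
Definition two_sided (L1 L2 : R -> {RV P >-> R}) (t : R) (w : T) : R :=
  if 0 <= t then L1 t w else lim (L2 s w @[s --> (- t)^'-]).

(* Requiring L t to be a random variable is no restriction on a complete
   probability space: two_sided L1 L2 t is almost surely equal to a random
   variable. *)
Definition two_sided_levy_process (L : R -> {RV P >-> R}) : Prop :=
  exists L1 L2 : R -> {RV P >-> R},
    [/\ levy_process L1, levy_process L2, same_law L1 L2,
        independent_processes L1 L2
      & forall t w, L t w = two_sided L1 L2 t w].

Definition levy_measure (nu : {measure set (measurableTypeR R) -> \bar R})
    : Prop :=
  nu [set 0] = 0%E /\ (\int[nu]_x (minr 1 (x ^+ 2))%:E < +oo)%E.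

(* (gamma, sigma2, nu) is the characteristic triplet of L with respect to the
   truncation 1_{|x| <= 1}, i.e. E[exp(i u L_t)] = exp(t psi(u)) where
     psi(u) = i gamma u - sigma2 u^2 / 2
              + \int (exp(i u x) - 1 - i u x 1_{|x| <= 1}) nu(dx).
   psi_re and psi_im are the real and imaginary parts of psi, and the identity
   is stated for the real and imaginary parts. *)
Definition characteristic_triplet (L : R -> {RV P >-> R}) (gamma sigma2 : R)
    (nu : {measure set (measurableTypeR R) -> \bar R}) : Prop :=
  let psi_re u :=
    - (sigma2 * u ^+ 2 / 2) + \int[nu]_x (cos (u * x) - 1) in
  let psi_im u :=
    gamma * u + \int[nu]_x (sin (u * x) - u * x * \1_(`[-1, 1]) x) in
  [/\ 0 <= sigma2, levy_measure nu &
      forall t u : R, 0 <= t ->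
        ('E_P[(fun w => cos (u * L t w))%R] =
           (expR (t * psi_re u) * cos (t * psi_im u))%:E)%E /\
        ('E_P[(fun w => sin (u * L t w))%R] =
           (expR (t * psi_re u) * sin (t * psi_im u))%:E)%E].

Definition without_brownian_component (L : R -> {RV P >-> R}) : Prop :=
  exists gamma nu, characteristic_triplet L gamma 0 nu.

Definition driving_levy_process (L : R -> {RV P >-> R}) : Prop :=
  [/\ two_sided_levy_process L,
      forall t, ('E_P[L t] = 0)%E,
      ('E_P[(fun w => L 1 w ^+ 2)%R] < +oo)%E
    & without_brownian_component L].

End LevyProcesses.

Section FractionalLevyProcess.
Context {disp : measure_display} {T : measurableType disp} {R : realType}.
Variable P : probability T R.

(* The list of the (c, a, b), where a <= b, encodes the step function
   \sum c * 1_{]a, b]}. *)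
Definition step_wf (q : seq (R * R * R)) : bool :=
  all (fun cab => cab.1.2 <= cab.2) q.

Definition step_fun (q : seq (R * R * R)) (s : R) : R :=
  \sum_(cab <- q) cab.1.1 * \1_(`]cab.1.2, cab.2]) s.

Definition step_integral (L : R -> {RV P >-> R}) (q : seq (R * R * R))
    (w : T) : R :=
  \sum_(cab <- q) cab.1.1 * (L cab.2 w - L cab.1.2 w).

(* Y is (a version of) the integral of f with respect to L in the
   L^2(Omega)-sense. *)
Definition is_L2_integral (L : R -> {RV P >-> R}) (f : R -> R)
    (Y : {RV P >-> R}) : Prop :=
  exists q : nat -> seq (R * R * R),
    [/\ forall n, step_wf (q n),
        (\int[lebesgue_measure]_s ((step_fun (q n) s - f s) ^+ 2)%:E)%E
          @[n --> \oo] --> 0%E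
      & ('E_P[(fun w => (step_integral L (q n) w - Y w) ^+ 2)%R])%E
          @[n --> \oo] --> 0%E].

(* X is the fractional Levy process with parameter d driven by L, in the
   modification given by the pathwise improper Riemann integral.  The
   integrand of the latter has its singularities at s = 0 and s = t; for
   t = 0 the two coincide (and the integrand is 0), hence the undup. *)
Definition fractional_levy_process (d : R) (L X : R -> {RV P >-> R}) : Prop :=
  [/\ driving_levy_process P L,
      forall t, is_L2_integral L
        (fun s => (Gamma (d + 1))^-1 *
                  (pos_powR (t - s) d - pos_powR (- s) d)) (X t)
    & {ae P, forall w, forall t, exists2 v,
        is_improper_Riemann_integral_line
          (fun s => (pos_powR (t - s) (d - 1) - pos_powR (- s) (d - 1)) * L s w)
          (undup [:: minr t 0; maxr t 0]) v
        & X t w = (Gamma d)^-1 * v}].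

End FractionalLevyProcess.

(* Main.v *)
(** Fix 1/2 < beta < min(1 - d, alpha - d).  Almost surely the driving process
   satisfies |L_s| <= C max(1, |s|)^beta for all s < 0.  Inserting this into the
   pathwise integral and scaling by t gives |L^d_t| <= C' |t|^(d + beta) for
   t <= -1, and d + beta < alpha.

   For the growth of L: the variance at integer times grows linearly, stochastic
   continuity and stationarity make the tails of L_r uniformly small over
   r in [0, 1], and Ottaviani's inequality on finer and finer dyadic grids of
   [0, 2^n] then gives P(sup |L| > 2 * 2^(n beta)) <= K 2^(n (1 - 2 beta)).  This
   is summable, so Borel-Cantelli and right continuity conclude. *)

Require Import Defs.
From mathcomp Require Import all_boot all_order all_algebra.
From mathcomp Require Import all_classical all_reals all_analysis.
From mathcomp Require Import measurable_realfun ring lra.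

Import Order.TTheory GRing.Theory Num.Def Num.Theory.
Import numFieldNormedType.Exports.

Local Open Scope classical_set_scope.
Local Open Scope ring_scope.

(** * Bounds on improper Riemann integrals *)

(** The two lower limits on the exponents have separate origins: 2^(n (1 - 2 beta)) is summable
    because beta > 1/2, and the difference of the two kernels decays like |s|^(d - 2), so that
    against |s|^beta it is integrable at -oo because d + beta < 1. Both fit together since d < 1/2.
    The pathwise integral is given as a limit of Riemann sums of a function with jumps and with
    singularities at t and 0. It is bounded through explicit primitives H with H' >= |f|. Their
    increments are at most a constant times |t|^(d + beta), uniformly in the endpoints, which does
    the work of the substitution s = |t| r. The moment hypothesis concerns L 1, so variances are
    computed at integer times only; other times are handled in probability. *)

Section RiemannBounds.
Context {R : realType}.
Implicit Types (f H h : R -> R) (a b v : R).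

(* Only the Riemann sums over uniform partitions whose tags are the given points
   xi are used: they are bounded by a telescoping sum. *)
Lemma ler_norm_Riemann_integral f H a b v : is_Riemann_integral f a b v ->
  (forall u w, a <= u -> u < w -> w <= b ->
     exists2 xi, u <= xi <= w & `|f xi| * (w - u) <= H w - H u) ->
  `|v| <= H b - H a.
Proof.
move=> [ab fv] fH; apply/ler_addgt0Pr => e e0.
have [delta delta0 fdelta] := fv e e0.
move: ab; rewrite le_eqVlt => /predU1P[ab|ab].
  have := fdelta 0%N (fun=> a) (fun=> a) erefl ab (fun i => ltac:(by [])).
  by rewrite big_ord0 sub0r normrN ab subrr add0r => /ltW.
pose n := (truncn ((b - a) / delta)).+1.
have n0 : (0 : R) < n%:R by rewrite ltr0n.
pose x i := a + i%:R * ((b - a) / n%:R).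
have xS i : x i.+1 - x i = (b - a) / n%:R.
  by rewrite /x -natr1 mulrDl mul1r; ring.
have dn0 : 0 < (b - a) / n%:R by rewrite divr_gt0// subr_gt0.
have xn : x n = b by rewrite /x mulrC divfK ?gt_eqF// addrC subrK.
have /choice[xi xiP] : forall i, exists t, (i < n)%N ->
    x i <= t <= x i.+1 /\ `|f t| * (x i.+1 - x i) <= H (x i.+1) - H (x i).
  move=> i; have [ltin|] := ltnP i n; last by exists 0.
  have [|||t xt ft] := fH (x i) (x i.+1).
  - by rewrite lerDl mulr_ge0// ltW.
  - by rewrite -subr_gt0 xS.
  - by rewrite -xn lerD2l ler_pM2r// ler_nat.
  - by exists t.
have mesh i : (i < n)%N -> x i <= xi i <= x i.+1 /\ x i.+1 - x i < delta.
  move=> ltin; split; first exact: (xiP i ltin).1.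
  by rewrite xS ltr_pdivrMr// mulrC -ltr_pdivrMr// truncnS_gt.
have := fdelta n x xi; rewrite {1}/x mul0r addr0 => /(_ erefl xn mesh) se.
have sH : `|\sum_(i < n) f (xi i) * (x i.+1 - x i)| <= H b - H a.
  rewrite -xn (_ : H a = H (x 0%N)); last by rewrite /x mul0r addr0.
  rewrite -(telescope_sumr (H \o x) (leq0n n)) big_mkord.
  apply: (le_trans (ler_norm_sum _ _ _)); apply: ler_sum => i _.
  rewrite normrM [X in _ * X]ger0_norm; last by rewrite xS ltW.
  exact: (xiP i (ltn_ord i)).2.
set s := \sum_(i < n) _ in se sH.
rewrite -[v](subrK s) addrC (le_trans (ler_normD _ _))// lerD// distrC.
exact: ltW.
Qed.

(** The mean value theorem supplies the tags: in each cell there is a point where [h] equals the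
    slope of [H], and [f] is sampled there. *)
Lemma ler_norm_Riemann_integral_deriv f H h a b v :
  is_Riemann_integral f a b v ->
  (forall x, a <= x <= b -> is_derive x 1 H (h x) /\ `|f x| <= h x) ->
  `|v| <= H b - H a.
Proof.
move=> fv Hh; apply: (@ler_norm_Riemann_integral f H a b v fv) => u w au uw wb.
have abP x : x \in `[u, w] -> a <= x <= b.
  by rewrite in_itv/= => /andP[ux xw]; rewrite (le_trans au)//= (le_trans xw).
have [||x xuw ->] := MVT uw (f := H) (df := h).
- by move=> x /subset_itv_oo_cc/abP/Hh[].
- apply: derivable_within_continuous => x /abP/Hh[dH _].
  exact: ex_derive.
- have := subset_itv_oo_cc xuw; rewrite in_itv/= => xuw'.
  exists x => //; rewrite ler_wpM2r//; first by rewrite subr_ge0 ltW.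
  exact: (Hh _ (abP _ (subset_itv_oo_cc xuw))).2.
Qed.

Lemma ler_norm_improper_Riemann_integral f (F G : set_system R) v K :
  ProperFilter F -> ProperFilter G ->
  is_improper_Riemann_integral f F G v ->
  (\forall x \near F & y \near G,
     forall I, is_Riemann_integral f x y I -> `|I| <= K) ->
  `|v| <= K.
Proof.
move=> FF GG fv fK; apply/ler_addgt0Pr => e e0.
have [[x y]/= [fI [I /fI IK Ie]]] := filter_ex (filterI fK (fv e e0)).
rewrite -[v](subrK I) addrC (le_trans (ler_normD _ _))// lerD// distrC.
exact: ltW.
Qed.

End RiemannBounds.

(** * Pointwise bounds for the kernel *)

Section FractionalKernel.
Context {R : realType}.
Implicit Types (a b c d s t u w x y : R).

Lemma pos_powR_id x p : 0 <= x -> pos_powR x p = x `^ p.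
Proof. by move=> x0; rewrite /pos_powR max_l. Qed.

Lemma pos_powR_eq0 x p : p != 0 -> x <= 0 -> pos_powR x p = 0.
Proof. by move=> p0 x0; rewrite /pos_powR max_r// powR0. Qed.

Lemma is_derive_powR_sub a c x : x < c ->
  is_derive x 1 (fun s : R => (c - s) `^ a) (- (a * (c - x) `^ (a - 1))).
Proof.
move=> xc; have d1 : is_derive x 1 (fun s : R => c - s) (-1).
  have := is_deriveB (is_derive_cst c x 1) (is_derive_id x (1 : R)).
  by rewrite sub0r.
have d2 : is_derive (c - x) 1 (fun y : R => y `^ a) (a * (c - x) `^ (a - 1)).
  by apply: is_derive1_powR; rewrite subr_gt0.
have := @is_derive1_comp R (fun y : R => y `^ a) (fun s : R => c - s) x _ _ d2 d1.
by rewrite mulrN1.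
Qed.

Lemma powRB1 x a : 0 < x -> x `^ (a - 1) = x `^ a / x.
Proof.
move=> x0; rewrite powRB ?powRr1 ?ltW//.
by apply/implyP => _; rewrite gt_eqF.
Qed.

(** Replacing w^d by u^d in u^d / u - w^d / w gives the upper bound. It keeps the integrable
    singularity u^(d - 1) at 0, where the mean value theorem would give u^(d - 2), and still gains a
    factor 1 / w at infinity. *)
Lemma powR_sub_le d u w : 0 < d -> d < 1 -> 0 < u -> u <= w ->
  0 <= u `^ (d - 1) - w `^ (d - 1) <= (w - u) * (u `^ (d - 1) / w).
Proof.
move=> d0 d1 u0 uw; have w0 : 0 < w by exact: lt_le_trans uw.
have dw : u `^ d <= w `^ d by apply: ge0_ler_powR; rewrite ?nnegrE//; exact: ltW.
apply/andP; split.
  rewrite subr_ge0 -(opprB 1 d) !powRN lef_pV2 ?posrE ?powR_gt0//.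
  by apply: ge0_ler_powR; rewrite ?nnegrE; lra.
rewrite !powRB1//.
have -> : (w - u) * (u `^ d / u / w) = u `^ d / u - u `^ d / w.
  by field; rewrite !gt_eqF.
by rewrite lerD2l lerN2 ler_pM2r// invr_gt0.
Qed.

(* With u = c - s and w = - s, where w - u = T: a function with derivative
   kernel_majorant.  The first term dominates the kernel for u >= T, the second
   one for u <= T.  We write 0 - s to share is_derive_powR_sub with c - s. *)
Definition kernel_primitive (d beta T c s : R) : R :=
  2 / (1 - d - beta) * T * (0 - s) `^ (- (1 - d - beta)) -
  2 * T `^ (beta + d) / d * ((c - s) `^ d * (0 - s) `^ (- d)).

Definition kernel_majorant (d beta T c s : R) : R :=
  2 * T * (0 - s) `^ (d + beta - 2) +
  2 * T `^ (beta + d) * T * ((c - s) `^ (d - 1) * (0 - s) `^ (- d - 1)).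

(** Up to a constant factor the second term is ((t - s) / (- s))^d. The derivative of the quotient
    is t / s^2, which produces the factor - t and the power d - 1 of t - s. *)
Lemma is_derive_kernel_primitive d beta t s :
  0 < d -> d + beta < 1 -> t < 0 -> s < t ->
  is_derive s 1 (kernel_primitive d beta (- t) t)
    (kernel_majorant d beta (- t) t s).
Proof.
move=> d0 db t0 st; have s0 : s < 0 by exact: lt_trans t0.
have D1 := @is_derive_powR_sub (- (1 - d - beta)) 0 s s0.
have D2 := @is_derive_powR_sub (- d) 0 s s0.
have D3 := @is_derive_powR_sub d t s st.
rewrite /kernel_primitive.
apply: is_derive_eq; rewrite /kernel_majorant.
have -> : - (1 - d - beta) - 1 = d + beta - 2 by ring.
set p := (0 - s) `^ (d + beta - 2).
rewrite !powRB1 ?subr_gt0//.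
rewrite /GRing.scale/=.
set A := (0 - s) `^ _; set B := (t - s) `^ _; set C := (- t) `^ _.
field.
by apply/and4P; split; apply/eqP => E; lra.
Qed.

(** Put T = - t, u = t - s and w = - s = u + T. If u <= T then w <= 2 T, which bounds w^(beta + d);
    otherwise u >= w / 2, which bounds u^(d - 1). The powers of 2 that arise have exponents beta + d
    and 1 - d in [0, 1], hence the factors 2 in the majorant. *)
Lemma kernel_le_majorant d beta t s :
  0 < d -> 0 < beta -> d + beta < 1 -> t < 0 -> s < t ->
  - t * ((t - s) `^ (d - 1) / (- s)) * (- s) `^ beta <=
  kernel_majorant d beta (- t) t s.
Proof.
move=> d0 b0 db t0 st; have s0 : s < 0 by exact: lt_trans t0.
rewrite /kernel_majorant sub0r.
have t0' : 0 < - t by rewrite oppr_gt0.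
have s0' : 0 < - s by rewrite oppr_gt0.
have u0 : 0 < t - s by rewrite subr_gt0.
have w2 a : 0 <= a <= 1 -> 2 `^ a <= 2 :> R.
  move=> /andP[a0 a1]; rewrite -[leRHS]powRr1//; apply: ler_powR => //.
  by rewrite ler1n.
have -> : - t * ((t - s) `^ (d - 1) / - s) * (- s) `^ beta =
          - t * ((t - s) `^ (d - 1) * (- s) `^ (beta - 1)).
  by rewrite (powRB1 _ beta s0'); ring.
have [ut|tu] := leP (t - s) (- t).
  apply: (@le_trans _ _ (- t * ((t - s) `^ (d - 1) *
      (2 * (- t) `^ (beta + d) * (- s) `^ (- d - 1))))).
    rewrite ler_pM2l// ler_wpM2l ?powR_ge0//.
    have -> : beta - 1 = (beta + d) + (- d - 1) by ring.
    rewrite powRD; last by apply/implyP => _; rewrite gt_eqF.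
    rewrite ler_pM2r ?powR_gt0//.
    apply: (@le_trans _ _ ((2 * - t) `^ (beta + d))).
      by apply: ge0_ler_powR; rewrite ?nnegrE; lra.
    by rewrite powRM ?(ltW t0')// ler_pM2r ?powR_gt0// w2//; lra.
  rewrite [leLHS](_ : _ = 2 * (- t) `^ (beta + d) * - t *
      ((t - s) `^ (d - 1) * (- s) `^ (- d - 1))); last by ring.
  by rewrite lerDr !mulr_ge0 ?powR_ge0 ?(ltW t0').
apply: (@le_trans _ _ (- t * (2 * (- s) `^ (d - 1) * (- s) `^ (beta - 1)))).
  rewrite ler_pM2l// ler_wpM2r ?powR_ge0//.
  apply: (@le_trans _ _ ((- s / 2) `^ (d - 1))).
    rewrite -(opprB 1 d) !powRN lef_pV2 ?posrE ?powR_gt0//; last lra.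
    by apply: ge0_ler_powR; rewrite ?nnegrE; lra.
  rewrite powRM ?invr_ge0 ?(ltW s0')// mulrC ler_pM2r ?powR_gt0//.
  by rewrite -powR_inv1// -powRrM w2//; lra.
have -> : d + beta - 2 = (d - 1) + (beta - 1) by ring.
rewrite [in leRHS]powRD; last by apply/implyP => _; rewrite gt_eqF.
rewrite [leLHS](_ : _ =
  2 * - t * ((- s) `^ (d - 1) * (- s) `^ (beta - 1))); last by ring.
by rewrite lerDl !mulr_ge0 ?powR_ge0 ?(ltW t0').
Qed.

End FractionalKernel.

(** * From the growth of a path to the growth of its fractional integral *)

Section FractionalPaths.
Context {R : realType}.
Implicit Types (a b d beta C t v I : R) (x : R -> R).

Definition fractional_integrand d t x s :=
  (pos_powR (t - s) (d - 1) - pos_powR (- s) (d - 1)) * x s.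

(** Only the first term at [b] and the second one at [a] count, the other two having a favourable
    sign. The former is largest at b = t because its exponent is negative, and in the latter the
    quotient (t - a) / (- a) is at most 1. *)
Lemma kernel_primitive_incr d beta t a b :
  0 < d -> d + beta < 1 -> t < 0 -> a <= b -> b < t ->
  kernel_primitive d beta (- t) t b - kernel_primitive d beta (- t) t a <=
  (2 / (1 - d - beta) + 2 / d) * (- t) `^ (d + beta).
Proof.
move=> d0 db t0 ab bt; have nt0 : 0 < - t by lra.
have gam0 : 0 < 1 - d - beta by lra.
rewrite /kernel_primitive.
have A1 : - t * (0 - b) `^ (- (1 - d - beta)) <= (- t) `^ (d + beta).
  apply: (@le_trans _ _ (- t * (- t) `^ (- (1 - d - beta)))).
    rewrite ler_pM2l// !powRN lef_pV2 ?posrE ?powR_gt0//; last by lra.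
    by apply: ge0_ler_powR; rewrite ?nnegrE; lra.
  rewrite -{1}[- t]powRr1 ?(ltW nt0)// -powRD;
    last by apply/implyP => _; rewrite gt_eqF.
  by rewrite (_ : 1 + _ = d + beta)//; ring.
have A2 : (t - a) `^ d * (0 - a) `^ (- d) <= 1.
  rewrite powRN ler_pdivrMr ?powR_gt0; [|lra..].
  by rewrite mul1r; apply: ge0_ler_powR; rewrite ?nnegrE; lra.
have A3 : 0 <= (t - b) `^ d * (0 - b) `^ (- d) by rewrite mulr_ge0 ?powR_ge0.
have A4 : 0 <= - t * (0 - a) `^ (- (1 - d - beta)).
  by rewrite mulr_ge0 ?powR_ge0// ltW.
rewrite [beta + d]addrC.
move: A1 A2 A3 A4; set p := _ * _ `^ _; set q := _ * _; set r := _ * _.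
set p' := _ * _.
set K := (- t) `^ _ => A1 A2 A3 A4.
have K0 : 0 <= 2 * K / d by rewrite divr_ge0 ?mulr_ge0 ?powR_ge0 ?ltW.
have c0 : 0 <= 2 / (1 - d - beta) by rewrite divr_ge0 ?ltW.
have B1 := ler_wpM2l c0 A1.
have B2 := mulr_ge0 c0 A4.
have B3 := ler_wpM2l K0 A2.
have B4 := mulr_ge0 K0 A3.
set c := 2 / (1 - d - beta) in c0 B1 B2 *.
rewrite mulr1 in B3.
rewrite [leLHS](_ : _ = c * q - 2 * K / d * r - (c * p' - 2 * K / d * p));
  last by rewrite /q /p'; ring.
rewrite [leRHS](_ : _ = c * K + 2 * K / d); last by ring.
by lra.
Qed.

Lemma fractional_integral_left_le d beta C t x I a b :
  0 < d -> 0 < beta -> d + beta < 1 -> 0 <= C -> t <= -1 ->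
  (forall s, s < 0 -> `|x s| <= C * maxr 1 (- s) `^ beta) ->
  b < t -> is_Riemann_integral (fractional_integrand d t x) a b I ->
  `|I| <= C * ((2 / (1 - d - beta) + 2 / d) * (- t) `^ (d + beta)).
Proof.
move=> d0 b0 db C0 t1 xC bt; have t0 : t < 0 by lra.
have nt0 : 0 < - t by lra.
have d1 : d - 1 != 0 by apply/eqP => E; lra.
set g := fractional_integrand d t x => gI; have ab := gI.1.
have : `|I| <= C * kernel_primitive d beta (- t) t b -
               C * kernel_primitive d beta (- t) t a.
  apply: (@ler_norm_Riemann_integral_deriv R g
    (fun s => C * kernel_primitive d beta (- t) t s)
    (fun s => C * kernel_majorant d beta (- t) t s) a b I gI) => s /andP[as_ sb].
  have st : s < t by exact: le_lt_trans bt.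
  have s0 : s < 0 by exact: lt_trans t0.
  split.
    exact: (is_deriveZ C (is_derive_kernel_primitive _ _ _ _ d0 db t0 st)).
  rewrite /g /fractional_integrand !pos_powR_id ?subr_ge0 ?oppr_ge0
    ?(ltW st) ?(ltW s0)//.
  have ts : 0 < t - s by rewrite subr_gt0.
  have tns : t - s <= - s by lra.
  have d1' : d < 1 by lra.
  have /andP[k0 k1] := powR_sub_le _ _ _ d0 d1' ts tns.
  rewrite normrM ger0_norm//.
  have xs := xC _ s0.
  (* Since s < t <= -1, the maximum of 1 and - s is - s. *)
  rewrite max_r in xs; last by lra.
  have -> : C * kernel_majorant d beta (- t) t s =
            kernel_majorant d beta (- t) t s * C by rewrite mulrC.
  apply: (@le_trans _ _ ((- t * ((t - s) `^ (d - 1) / - s)) *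
                         (C * (- s) `^ beta))).
    apply: ler_pM => //.
    rewrite (le_trans k1)// ler_wpM2r//; last by lra.
    by rewrite mulr_ge0 ?powR_ge0// invr_ge0; lra.
  rewrite [C * _]mulrC mulrA ler_wpM2r//.
  exact: kernel_le_majorant.
move=> /le_trans; apply; rewrite -mulrBr ler_wpM2l//.
exact: kernel_primitive_incr.
Qed.

(** Between t and 0 the first kernel vanishes and |x s| <= C (- t)^beta, so only (- s)^(d - 1) has
    to be integrated. *)
Lemma fractional_integral_middle_le d beta C t x I a b :
  0 < d -> 0 < beta -> d + beta < 1 -> 0 <= C -> t <= -1 ->
  (forall s, s < 0 -> `|x s| <= C * maxr 1 (- s) `^ beta) ->
  t < a -> b < 0 -> is_Riemann_integral (fractional_integrand d t x) a b I ->
  `|I| <= C * (1 / d * (- t) `^ (d + beta)).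
Proof.
move=> d0 b0 db C0 t1 xC ta b_0; have t0 : t < 0 by lra.
have nt0 : 0 < - t by lra.
have d1 : d - 1 != 0 by apply/eqP => E; lra.
set g := fractional_integrand d t x => gI; have ab := gI.1.
have : `|I| <= - (C * (- t) `^ beta / d) * (0 - b) `^ d -
               - (C * (- t) `^ beta / d) * (0 - a) `^ d.
  apply: (@ler_norm_Riemann_integral_deriv R g
    (fun s => - (C * (- t) `^ beta / d) * (0 - s) `^ d)
    (fun s => C * (- t) `^ beta * (0 - s) `^ (d - 1)) a b I gI) => s /andP[as_ sb].
  have s0 : s < 0 by exact: le_lt_trans b_0.
  split.
    have := is_deriveZ (- (C * (- t) `^ beta / d)) (is_derive_powR_sub d _ _ s0).
    move/is_derive_eq; apply; rewrite /GRing.scale/=.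
    by field; rewrite gt_eqF.
  rewrite /g /fractional_integrand pos_powR_eq0//; last by lra.
  rewrite pos_powR_id; last by lra.
  rewrite !sub0r normrM normrN (ger0_norm (powR_ge0 _ _)) mulrC.
  rewrite ler_wpM2r ?powR_ge0//.
  rewrite (le_trans (xC _ s0))// ler_wpM2l//.
  apply: ge0_ler_powR; rewrite ?nnegrE ?le_max ?ge_max ?(ltW b0)//.
  - by rewrite ler01.
  - by lra.
  - by apply/andP; split; lra.
move=> /le_trans; apply.
have K0 : 0 <= C * (- t) `^ beta / d.
  by rewrite divr_ge0 ?mulr_ge0 ?powR_ge0 ?(ltW d0).
have A1 := mulr_ge0 K0 (powR_ge0 (0 - b) d).
have A2 : (0 - a) `^ d <= (- t) `^ d.
  by apply: ge0_ler_powR; rewrite ?nnegrE; lra.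
have A3 := ler_wpM2l K0 A2.
rewrite powRD; last by apply/implyP => _; rewrite gt_eqF.
have -> : C * (1 / d * ((- t) `^ d * (- t) `^ beta)) =
   C * (- t) `^ beta / d * (- t) `^ d by ring.
by move: A1 A3; lra.
Qed.

Lemma fractional_integral_right_le0 d t x I a b : d < 1 -> t <= 0 -> 0 < a ->
  is_Riemann_integral (fractional_integrand d t x) a b I -> `|I| <= 0.
Proof.
move=> d1 t0 a0; have d1' : d - 1 != 0 by apply/eqP => E; lra.
set g := fractional_integrand d t x => gI; rewrite -(subrr (0 : R)).
apply: (@ler_norm_Riemann_integral_deriv R g (cst 0) (cst 0) a b I gI).
move=> s /andP[as_ _]; split; first exact: is_derive_cst.
by rewrite /g /fractional_integrand !pos_powR_eq0 ?subrr ?mul0r ?normr0//; lra.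
Qed.

Lemma fractional_integral_le d beta C t x v :
  0 < d -> 0 < beta -> d + beta < 1 -> 0 <= C -> t <= -1 ->
  (forall s, s < 0 -> `|x s| <= C * maxr 1 (- s) `^ beta) ->
  is_improper_Riemann_integral_line (fractional_integrand d t x)
    (undup [:: minr t 0; maxr t 0]) v ->
  `|v| <= C * (2 / (1 - d - beta) + 3 / d) * (- t) `^ (d + beta).
Proof.
move=> d0 b0 db C0 t1 xC; have t0 : t < 0 by lra.
set g := fractional_integrand d t x.
rewrite min_l ?max_r ?(ltW t0)//= inE lt_eqF//=.
move=> [v1 [w [gv1 [v2 [v3 [gv2 gv3 ->]]] ->]]].
have B1 : `|v1| <= C * ((2 / (1 - d - beta) + 2 / d) * (- t) `^ (d + beta)).
  apply: (@ler_norm_improper_Riemann_integral R g -oo t^'- v1 _ _ _ gv1).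
  near=> a b; have bt : b < t by near: b; exact: nbhs_left_lt.
  by move=> I; exact: (@fractional_integral_left_le d beta C t x).
have B2 : `|v2| <= C * (1 / d * (- t) `^ (d + beta)).
  apply: (@ler_norm_improper_Riemann_integral R g t^'+ 0^'- v2 _ _ _ gv2).
  near=> a b; have bt : b < 0 by near: b; exact: nbhs_left_lt.
  have ta : t < a by near: a; exact: nbhs_right_gt.
  by move=> I; exact: (@fractional_integral_middle_le d beta C t x).
have B3 : `|v3| <= 0.
  apply: (@ler_norm_improper_Riemann_integral R g 0^'+ +oo v3 _ _ _ gv3).
  near=> a b; have a0 : 0 < a by near: a; exact: nbhs_right_gt.
  by move=> I; apply: (@fractional_integral_right_le0 d t x) => //; lra.
have := ler_normD v1 (v2 + v3); have := ler_normD v2 v3.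
(* Of the 3 / d, the interval ]-oo, t[ contributes 2 / d and ]t, 0[ contributes 1 / d. *)
have -> : C * (2 / (1 - d - beta) + 3 / d) * (- t) `^ (d + beta) =
  C * ((2 / (1 - d - beta) + 2 / d) * (- t) `^ (d + beta)) +
  C * (1 / d * (- t) `^ (d + beta)).
  by field; apply/andP; split; apply/eqP => E; lra.
by move: B1 B2 B3; lra.
Unshelve. all: by end_near. Qed.

End FractionalPaths.

(** * Growth of the driving process *)

Section MaximalInequality.
Context {disp : measure_display} {T : measurableType disp} {R : realType}.
Variable P : probability T R.

Lemma measurable_norm_gt d' (T' : measurableType d') (f : T' -> R) (c : R) :
  measurable_fun setT f -> measurable [set w | c < `|f w|].
Proof.
move=> mf; rewrite [X in measurable X](_ : _ = (normr \o f) @^-1` `]c, +oo[).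
  by rewrite -[X in measurable X]setTI; apply: (measurableT_comp _ mf).
by apply/seteqP; split => w /=; rewrite in_itv/= andbT.
Qed.

(** A pi-system generating the past of the last variable. Keeping all n + 1 indices lets the product
    rule apply with any set in the last slot. *)
Definition past_cylinders {n} (Y : 'I_n.+1 -> T -> R) : set (set T) :=
  [set D | exists B : 'I_n.+1 -> set R, (forall i, measurable (B i)) /\
     D = [set w | forall i, i != ord_max -> B i (Y i w)]].

(** As functions of [D], both sides are finite measures; they agree on the cylinders, hence on the
    generated sigma-algebra. *)
Lemma mutually_independent_last n (Y : 'I_n.+1 -> T -> R) (D : set T)
    (B : set R) :
  (forall i, measurable_fun setT (Y i)) -> mutually_independent P Y ->
  <<s past_cylinders Y >> D -> measurable B ->
  P (D `&` Y ord_max @^-1` B) = (P D * P (Y ord_max @^-1` B))%E.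
Proof.
move=> mY indY sD mB; set E := Y ord_max @^-1` B.
have mYB i C : measurable C -> measurable (Y i @^-1` C).
  by move=> mC; rewrite -[X in measurable X]setTI; exact: mY.
have mE : measurable E by exact: mYB.
have cylE (A : 'I_n.+1 -> set R) : [set w | forall i, i != ord_max -> A i (Y i w)] =
    \bigcap_(i in [set i | i != ord_max]) (Y i @^-1` A i).
  by apply/seteqP; split => w /= h i; exact: h.
pose m2 := mscale (NngNum (fine_ge0 (measure_ge0 P E))) P.
have m2E A : (P E * P A = m2 A)%E.
  by rewrite /m2 /mscale/= fineK ?fin_num_measure.
rewrite muleC m2E.
have -> : P (D `&` E) = mrestr P mE D by [].
apply: (@g_sigma_algebra_measure_unique _ R T (past_cylinders Y) _
  (fun=> setT)) => //.
- move=> _ [A [mA ->]]; rewrite cylE.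
  by apply: fin_bigcap_measurable => [|i _]; [exact: finite_finset|exact: mYB].
- by move=> _; exists (fun=> setT); split => //; apply/seteqP; split.
- by rewrite bigcup_const//; exists 0%N.
- move=> _ _ [A [mA ->]] [A' [mA' ->]]; exists (fun i => A i `&` A' i).
  split; first by move=> i; exact: measurableI.
  apply/seteqP; split => w /=.
    by move=> [h h'] i im; split; [exact: h|exact: h'].
  by move=> h; split => i /h[].
- move=> _ [A [mA ->]]; apply: etrans (m2E _).
  pose A' C i := if i == ord_max then C else A i.
  have mA' C : measurable C -> forall i, measurable (A' C i).
    by move=> mC i; rewrite /A'; case: ifP.
  (* C = [B] gives the intersection, C = [setT] the probability of the cylinder alone. *)
  have PA C : measurable C ->
      P ([set w | forall i, i != ord_max -> A i (Y i w)] `&` Y ord_max @^-1` C) =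
      (P (Y ord_max @^-1` C) *
       \prod_(i < n.+1 | i != ord_max) P (Y i @^-1` A i))%E.
    move=> mC; rewrite [X in P X](_ : _ = [set w | forall i, A' C i (Y i w)]).
      rewrite (indY _ (mA' _ mC)) (bigD1 ord_max)//= /A' eqxx; congr (_ * _)%E.
      by apply: eq_bigr => i /negbTE ->.
    apply/seteqP; split => w /=.
      by move=> [h hC] i; rewrite /A'; case: eqVneq => [->//|]; exact: h.
    move=> h; split; last by have := h ord_max; rewrite /A' eqxx.
    by move=> i im; have := h i; rewrite /A' (negbTE im).
  apply: etrans (PA B mB) _; congr (_ * _)%E.
  have := PA setT measurableT; rewrite preimage_setT setIT => ->.
  by rewrite probability_setT mul1e.
- by move=> _; rewrite /mrestr /= (le_lt_trans (probability_le1 _ _)) ?ltry// setTI.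
Qed.

(* Unlike Kolmogorov's inequality, this needs no second moments at the times
   t k, k < N. *)
Lemma ottaviani (X : R -> {RV P >-> R}) (t : nat -> R) (N : nat) (c : R) :
  independent_increments P X -> 0 <= t 0%N -> (forall i, t i <= t i.+1) ->
  (forall w, X (t 0%N) w = 0) ->
  (forall k, (k <= N)%N ->
     P [set w | (c < `|X (t N) w - X (t k) w|)%R] <= (2^-1)%:E)%E ->
  (P (\big[setU/set0]_(k < N.+1) [set w | (2 * c < `|X (t k) w|)%R]) <=
   2%:E * P [set w | (c < `|X (t N) w|)%R])%E.
Proof.
move=> indX t0 nd X0 tail.
pose E k := [set w | 2 * c < `|X (t k) w|].
have mE k : measurable (E k) by exact: measurable_norm_gt.
pose G k := [set w | c < `|X (t N) w - X (t k) w|].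
have mG k : measurable (G k).
  by apply: measurable_norm_gt; exact: measurable_funB.
have ndt : {homo t : i j / (i <= j)%N >-> i <= j}.
  exact: (homo_leq (@lexx _ _) (@le_trans _ _)).
(* [seqDU E k] says that the level 2 c is first exceeded at time [t k]: it depends on the increments
   up to [t k], and [G k] on the one from [t k] to [t N]. *)
have mD k : measurable (seqDU E k).
  by apply: measurableD => //; apply: bigsetU_measurable => i _; exact: mE.
have indD k : (k <= N)%N ->
    P (seqDU E k `&` ~` G k) = (P (seqDU E k) * P (~` G k))%E.
  (* Jumping from [t k] straight to [t N] makes X (t N) - X (t k) the last of k + 1 independent
     increments. *)
  move=> kN; pose s i := if (i <= k)%N then t i else t N.
  pose Y (i : 'I_k.+1) w := X (s i.+1) w - X (s i) w.
  have mY i : measurable_fun setT (Y i) by exact: measurable_funB.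
  have indY : mutually_independent P Y.
    apply: indX => [|i]; first by rewrite /s.
    rewrite ltnS /s => ik; rewrite ik; case: ifP => // _.
    by apply: ndt; exact: leq_trans kN.
  have YE : Y ord_max @^-1` (~` [set x : R | c < `|x|]) = ~` G k.
    by apply/seteqP; split => w /=; rewrite /Y /s ltnn leqnn.
  rewrite -YE; apply: mutually_independent_last => //; last first.
    by apply: measurableC; exact: (@measurable_norm_gt _ _ id).
  (* On [T] with the sigma-algebra of the past, membership of [seqDU E k] becomes measurability of
     the X (t j), which are sums of past increments because X (t 0) = 0. *)
  pose T' := g_sigma_algebraType (past_cylinders Y).
  have mX j : (j <= k)%N -> measurable_fun setT (X (t j) : T' -> R).
    elim: j => [_|j IH jk].
      rewrite (_ : X (t 0%N) = cst 0 :> (T' -> R))//.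
      by apply/funext => w; exact: X0.
    have jk' : (j < k.+1)%N by exact: ltnW.
    rewrite (_ : (X (t j.+1) : T' -> R) =
        (X (t j) : T' -> R) \+ (Y (Ordinal jk') : T' -> R)); last first.
      by apply/funext => w /=; rewrite /Y /s/= jk (ltnW jk) addrC subrK.
    apply: measurable_funD; first exact: IH (ltnW jk).
    move=> _ B mB; rewrite setTI; apply: sub_sigma_algebra.
    exists (fun i => if i == Ordinal jk' then B else setT); split.
      by move=> i; case: ifP.
    apply/seteqP; split => w /=.
      by move=> h i _; case: eqVneq => // ->.
    move=> /(_ (Ordinal jk')); rewrite eqxx; apply.
    by rewrite -val_eqE/= ltn_eqF.
  have mE' j : (j <= k)%N -> (measurable (E j : set T')).
    by move=> jk; apply: (@measurable_norm_gt _ T'); exact: mX.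
  have : measurable (seqDU E k : set T').
    apply: measurableD; first exact: mE'.
    by apply: bigsetU_measurable => i _; apply: mE'; exact: ltnW.
  by [].
rewrite (bigsetU_seqDU E) measure_bigsetU//.
have half k : (k <= N)%N -> ((2^-1)%:E <= P (~` G k))%E.
  move=> kN; rewrite probability_setC//.
  have := tail k kN; rewrite -/(G k) -[P (G k)]fineK ?fin_num_measure//.
  by rewrite -EFinB !lee_fin; lra.
have -> : (\sum_(k < N.+1) P (seqDU E k) =
    2%:E * \sum_(k < N.+1) ((2^-1)%:E * P (seqDU E k)))%E.
  by rewrite -ge0_sume_distrr// muleA -EFinM divff// mul1e.
apply: lee_pmul => //; first by rewrite sume_ge0// => i _; rewrite mule_ge0.
apply: (@le_trans _ _ (\sum_(k < N.+1) P (seqDU E k `&` ~` G k))%E).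
  apply: lee_sum => /= i _; have iN : (i <= N)%N by rewrite -ltnS.
  by rewrite (indD _ iN) muleC lee_pmul ?half//.
rewrite -(@measure_bigsetU _ _ _ P (fun k => seqDU E k `&` ~` G k))//; last 2 first.
- by move=> i; apply: measurableI => //; exact: measurableC.
- apply: (sub_trivIset (subsetT _)); exact: trivIset_setIr.
rewrite le_measure ?inE//.
- apply: bigsetU_measurable => i _; apply: measurableI => //; exact: measurableC.
- exact: measurable_norm_gt.
(* |X (t k)| > 2 c and |X (t N) - X (t k)| <= c force |X (t N)| > c. *)
- rewrite -(bigcup_mkord _ (fun k => seqDU E k `&` ~` G k)) => w [k /= kN [[Ek _]]].
  rewrite /G /= => /negP; rewrite -leNgt => Gk.
  have := ler_normB (X (t N) w) (X (t N) w - X (t k) w).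
  rewrite opprB addrC subrK; move: Ek Gk; rewrite /E/=; lra.
Qed.

End MaximalInequality.

(** * Moments under independence and under equality in law *)

Section IndependentVariables.
Context {disp : measure_display} {T : measurableType disp} {R : realType}.
Variable P : probability T R.
Implicit Types A B : {RV P >-> R}.

(** The joint law is the product of the marginals, and in Fubini's theorem the inner integral at x
    is x E[B] = 0. *)
Lemma expectation_mul_independent A B :
  (A : T -> R) \in Lfun P 2%:E -> (B : T -> R) \in Lfun P 2%:E ->
  (forall C D : set R, measurable C -> measurable D ->
    P (A @^-1` C `&` B @^-1` D) = (P (A @^-1` C) * P (B @^-1` D))%E) ->
  ('E_P[B] = 0 -> 'E_P[((A : T -> R) * (B : T -> R))%R] = 0)%E.
Proof.
move=> A2 B2 AB B0.
have Pfin : P setT \is a fin_num := fin_num_measure P _ measurableT.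
pose phi w : R * R := (A w, B w).
have mphi : measurable_fun setT phi by exact: measurable_fun_pair.
pose f (z : R * R) := (z.1 * z.2)%:E.
have mf : measurable_fun setT f.
  by apply/measurable_EFinP; apply: measurable_funM.
have /Lfun1_integrable intf := Lfun2_mul_Lfun1 A2 B2.
have intB := (Lfun1_integrable _ _).1 (Lfun_subset12 Pfin B2).
have prodE : forall X : set (R * R), measurable X ->
    (distribution P A \x distribution P B)%E X = pushforward P phi X.
  move=> X mX.
  apply: (product_measure_unique (m' := pushforward P phi)); last exact: mX.
  by move=> C D mC mD; exact: AB.
have intf' : (pushforward P phi).-integrable setT f.
  by apply: integrable_pushforward.
rewrite unlock.
transitivity (\int[pushforward P phi]_z f z)%E.
  by rewrite integral_pushforward.
transitivity (\int[distribution P A \x distribution P B]_z f z)%E.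
  by apply: eq_measure_integral => X mX _; exact/esym/prodE.
rewrite -integral12_prod_meas1.
  apply: integral0_eq => x _; rewrite /fubini_F /f/=.
  under eq_integral do rewrite EFinM.
  have int_id : (distribution P B).-integrable setT (EFin : R -> _).
    by apply: (@integrable_pushforward _ _ _ _ _ (B : T -> R)).
  rewrite integralZl// integral_distribution//.
  by move: B0; rewrite unlock => ->; rewrite mule0.
apply/integrableP; split=> //.
rewrite (eq_measure_integral (pushforward P phi)); last first.
  by move=> X mX _; exact: prodE.
by case/integrableP : intf'.
Qed.

Lemma Lfun2_sqr_lty (f : T -> R) : measurable_fun setT f ->
  ('E_P[(fun w => f w ^+ 2)%R] < +oo)%E -> f \in Lfun P 2%:E.
Proof.
rewrite unlock => mf f2; rewrite inE; apply/andP; split; rewrite inE//=.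
rewrite /finite_norm unlock; apply: poweR_lty.
apply: le_lt_trans f2; rewrite le_eqVlt; apply/orP; left; apply/eqP.
apply: eq_integral => w _.
by rewrite /= powR_mulrn// real_normK// num_real.
Qed.

Lemma eq_law_sqr (X Y : {RV P >-> R}) :
  (forall B : set R, measurable B -> P (X @^-1` B) = P (Y @^-1` B)) ->
  ('E_P[(fun w => X w ^+ 2)%R] = 'E_P[(fun w => Y w ^+ 2)%R])%E.
Proof.
move=> XY; rewrite unlock.
have mf : measurable_fun setT (fun x : R => (x ^+ 2)%:E).
  by apply/measurable_EFinP; exact: measurable_funX.
transitivity (\int[distribution P X]_x (x ^+ 2)%:E)%E.
  by rewrite ge0_integral_distribution// => x; rewrite lee_fin sqr_ge0.
transitivity (\int[distribution P Y]_x (x ^+ 2)%:E)%E.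
  by apply: eq_measure_integral => B mB _; exact: XY.
by rewrite ge0_integral_distribution// => x; rewrite lee_fin sqr_ge0.
Qed.

Lemma eq_law_expectation (X Y : {RV P >-> R}) :
  (forall B : set R, measurable B -> P (X @^-1` B) = P (Y @^-1` B)) ->
  (X : T -> R) \in Lfun P 1 -> (Y : T -> R) \in Lfun P 1 ->
  ('E_P[X] = 'E_P[Y])%E.
Proof.
move=> XY /Lfun1_integrable iX /Lfun1_integrable iY; rewrite unlock.
transitivity (\int[distribution P X]_x x%:E)%E.
  by rewrite integral_distribution.
transitivity (\int[distribution P Y]_x x%:E)%E.
  by apply: eq_measure_integral => B mB _; exact: XY.
by rewrite integral_distribution.
Qed.

End IndependentVariables.

(** * Variance at integer times, tails over the unit interval *)

Section Tails.
Context {disp : measure_display} {T : measurableType disp} {R : realType}.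
Variable P : probability T R.

(** By induction: Z (n + 1) - Z n is independent of Z n and has the law of Z 1, so the covariance
    vanishes and the variances add up. *)
Lemma variance_nat (Z : R -> {RV P >-> R}) :
  independent_increments P Z -> stationary_increments P Z ->
  (forall w, Z 0 w = 0) -> (Z 1 : T -> R) \in Lfun P 2%:E ->
  ('E_P[Z 1%R] = 0)%E ->
  forall n : nat, [/\ (Z n%:R : T -> R) \in Lfun P 2%:E,
    ('E_P[Z n%:R%R] = 0)%E &
    ('V_P[Z n%:R%R] = n%:R%:E * 'V_P[Z 1%R])%E].
Proof.
move=> indZ statZ Z0 Z1 EZ1; elim=> [|n [L2 E0 Vn]].
  have -> : (Z 0%:R : T -> R) = cst 0 by apply/funext => w; exact: Z0.
  by rewrite Lfun_cst expectation_cst variance_cst mul0e.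
pose B : {RV P >-> R} := Z n.+1%:R \- Z n%:R.
have lawB D : measurable D -> P (Z 1 @^-1` D) = P (B @^-1` D).
  move=> mD; have := statZ n%:R 1 (ler0n _ _) ler01 D mD.
  rewrite natr1 => ->; congr (P _).
  by apply/seteqP; split => w /=; rewrite Z0 subr0.
have Pfin : P setT \is a fin_num := fin_num_measure P _ measurableT.
have B2 : (B : T -> R) \in Lfun P 2%:E.
  apply: Lfun2_sqr_lty; first exact: measurable_funPT.
  rewrite -(eq_law_sqr _ _ _ lawB) unlock.
  exact: (integrable_lty measurableT (Lfun2_integrable_sqr Z1)).
have Z11 := Lfun_subset12 Pfin Z1.
have B1 := Lfun_subset12 Pfin B2.
have L1 := Lfun_subset12 Pfin L2.
have EB : ('E_P[B] = 0)%E by rewrite -(eq_law_expectation _ _ _ lawB).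
have ZE : (Z n.+1%:R : T -> R) = Z n%:R \+ B.
  by apply/funext => w /=; rewrite addrC subrK.
have indB (C D : set R) : measurable C -> measurable D ->
    P (Z n%:R @^-1` C `&` B @^-1` D) = (P (Z n%:R @^-1` C) * P (B @^-1` D))%E.
  (* The times 0, n, n + 1, whose two increments are Z n and [B]. *)
  move=> mC mD; pose t (i : nat) : R := if i is i'.+1 then (n + i')%:R else 0.
  have indt : mutually_independent P
      (fun (i : 'I_2) w => Z (t i.+1) w - Z (t i) w).
    apply: indZ => // -[|i] _ /=; first by rewrite ler0n.
    by rewrite ler_nat addnS.
  have mF (i : 'I_2) : measurable (if i == ord0 then C else D) by case: ifP.
  have := indt _ mF; rewrite !big_ord_recl big_ord0 mule1 /= /t/= addn0 addn1.
  have -> : (fun w => Z n%:R w - Z 0 w) = Z n%:R.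
    by apply/funext => w; rewrite Z0 subr0.
  move=> <-; congr (P _); apply/seteqP; split => w /=.
    move=> [Cw Dw] i; case: ifPn => [/eqP -> /=|].
      by rewrite Z0 subr0 addn0.
    by case: i => -[|[|//]]//= _ _; rewrite addn0 addn1.
  by move=> h; split; [have := h ord0|have := h (lift ord0 ord0)];
    rewrite /= ?Z0 ?subr0 ?addn0 ?addn1.
split.
- by rewrite ZE rpredD// lee1n.
- by rewrite ZE expectationD// E0 EB adde0.
- have ZB : (Z n%:R : T -> R) * (B : T -> R) \in Lfun P 1.
    exact: Lfun2_mul_Lfun1.
  rewrite ZE varianceD// covarianceE// expectation_mul_independent// E0 mul0e sube0.
  rewrite mule0 adde0 Vn -[n.+1%:R]natr1 EFinD.
  rewrite ge0_muleDl ?lee_fin ?ler01 ?ler0n// mul1e; congr (_ + _)%E.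
  rewrite !varianceE// EB EZ1; congr (_ - _)%E.
  exact/esym/eq_law_sqr.
Qed.

Lemma norm_tail_cvg0 (X : {RV P >-> R}) (e : R) : 0 < e ->
  \forall M \near +oo, (P [set w | (M < `|X w|)%R] <= e%:E)%E.
Proof.
move=> e0.
have /fine_cvgP[_ /cvgrPdist_le/(_ _ e0)] := @cvg_ccdfy0 _ _ _ P (normr \o X).
have mA M : measurable [set w | M < `|X w|] by exact: measurable_norm_gt.
apply: filterS => M /=; rewrite sub0r normrN.
rewrite (_ : ccdf _ _ = P [set w | M < `|X w|]); last first.
  by congr (P _); apply/seteqP; split => w /=; rewrite in_itv/= andbT.
rewrite ger0_norm ?fine_ge0// => h.
by rewrite -[leLHS]fineK ?fin_num_measure// lee_fin.
Qed.

Lemma norm_tailD (X Y : T -> R) (a b : R) :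
  measurable_fun setT X -> measurable_fun setT Y ->
  (P [set w | (a + b < `|X w + Y w|)%R] <=
   P [set w | (a < `|X w|)%R] + P [set w | (b < `|Y w|)%R])%E.
Proof.
move=> mX mY.
have mXa := measurable_norm_gt _ T X a mX.
have mYb := measurable_norm_gt _ T Y b mY.
apply: (le_trans _ (measureU2 _ mXa mYb)).
apply: le_measure; rewrite ?inE.
- by apply: measurable_norm_gt; exact: measurable_funD.
- exact: measurableU.
- move=> w /= ab; have [aX|Xa] := ltP a `|X w|; first by left.
  right; rewrite -(ltrD2l a) (lt_le_trans ab)// (le_trans (ler_normD _ _))//.
  by rewrite lerD2r.
Qed.

(** Near a fixed r, Z s is within 1 of Z r up to probability e / 2, and |Z r| exceeds M - 1 with
    probability at most e / 2 for large M. Compactness of [0, 1] makes M uniform. *)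
Lemma uniform_tail_unit (Z : R -> {RV P >-> R}) (e : R) : 0 < e ->
  stochastically_continuous P Z ->
  \forall M \near +oo, forall r, 0 <= r <= 1 ->
    (P [set w | (M < `|Z r w|)%R] <= e%:E)%E.
Proof.
move=> e0 scZ; have e20 : 0 < e / 2 by rewrite divr_gt0.
have := (@segment_compact R 0 1).
move/compact_near_coveringP/near_covering_withinP.
move=> /(_ R (pinfty_nbhs R)
  (fun M r : R => (P [set w | (M < `|Z r w|)%R] <= e%:E)%E)).
suff H : forall r : R, `[0, 1]%classic r -> \forall s \near r & M \near +oo,
    `[0, 1]%classic s -> (P [set w | (M < `|Z s w|)%R] <= e%:E)%E.
  have FF : Filter (pinfty_nbhs R) by exact: _.
  move=> /(_ FF H); apply: filterS => M h r r01.
  by apply: h; rewrite /= in_itv.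
move=> r; rewrite /= in_itv/= => /andP[r0 r1].
have A : \forall s \near r, 0 <= s ->
    (P [set w | (1 < `|Z s w - Z r w|)%R] <= (e / 2)%:E)%E.
  have /fine_cvgP[_ /cvgrPdist_le/(_ _ e20)] := scZ r 1 r0 ltr01.
  apply: filterS => s /=; rewrite sub0r normrN.
  rewrite ger0_norm ?fine_ge0// => h'.
  rewrite -[leLHS]fineK ?lee_fin// fin_num_measure//.
  by apply: measurable_norm_gt; exact: measurable_funB.
have [M0 [_ B]] := norm_tail_cvg0 (Z r) _ e20.
near=> s M => /=; rewrite in_itv/= => /andP[s0 s1].
have sr : (P [set w | (1 < `|Z s w - Z r w|)%R] <= (e / 2)%:E)%E.
  by move: s0; near: s; exact: A.
have M1 : M0 < M - 1.
  by rewrite ltrBrDr; near: M; apply: nbhs_pinfty_gt; rewrite num_real.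
rewrite (splitr e) EFinD; apply: (le_trans _ (leeD sr (B _ M1))).
have -> : [set w | M < `|Z s w|] =
    [set w | 1 + (M - 1) < `|(Z s w - Z r w) + Z r w|].
  by apply/seteqP; split => w /=; rewrite subrK [1 + _]addrC subrK.
by apply: norm_tailD => //; exact: measurable_funB.
Unshelve. all: by end_near. Qed.

End Tails.

(** * Dyadic grids, tails at all times up to 2^n *)

Section DyadicGrowth.
Context {disp : measure_display} {T : measurableType disp} {R : realType}.
Variable P : probability T R.

Definition dyadic (n m k : nat) : R := k%:R * (2 ^+ n / 2 ^+ m).

Definition dyadic_exceedance (Z : R -> {RV P >-> R}) (c : R) (n m : nat) :=
  \big[setU/set0]_(k < (2 ^ m).+1) [set w | 2 * c < `|Z (dyadic n m k) w|].

Lemma tail_nat (Z : R -> {RV P >-> R}) (v c : R) (n : nat) : 0 < c ->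
  ('E_P[Z n%:R%R] = 0)%E -> ('V_P[Z n%:R%R] = (n%:R * v)%:E)%E ->
  (P [set w | (c < `|Z n%:R w|)%R] <= (n%:R * v / c ^+ 2)%:E)%E.
Proof.
move=> c0 E0 Vn; have := chebyshev (Z n%:R) c0.
rewrite E0 Vn -EFinM [c ^- 2 * _]mulrC /=; apply: le_trans; apply: le_measure.
- by rewrite inE; exact: measurable_norm_gt.
- rewrite inE [X in measurable X](_ : _ = ~` [set w | `|Z n%:R w| < c]).
    apply: measurableC; rewrite [X in measurable X](_ : _ =
      (normr \o Z n%:R) @^-1` `]-oo, c[).
      rewrite -[X in measurable X]setTI.
      by apply: (measurableT_comp _ (measurable_funPT (Z n%:R))).
    by apply/seteqP; split => w /=; rewrite in_itv.
  apply/seteqP; split => w /=; rewrite subr0; last by move=> /negP; rewrite -leNgt.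
  by move=> cZ; apply/negP; rewrite -leNgt.
- by move=> w /= /ltW; rewrite subr0.
Qed.

(** Split u into its integer part k and a remainder. Chebyshev bounds Z k, whose variance is at most
    2^n v and so negligible against a^(2 n); the increment Z u - Z k has the law of Z (u - k), with
    u - k in [0, 1]. Each part is allotted 1/4. *)
Lemma tail_half (Z : R -> {RV P >-> R}) (v a : R) :
  1 < a -> 2 < a ^+ 2 -> 0 <= v -> stationary_increments P Z ->
  stochastically_continuous P Z -> (forall w, Z 0 w = 0) ->
  (forall n : nat, ('E_P[Z n%:R%R] = 0)%E) ->
  (forall n : nat, ('V_P[Z n%:R%R] = (n%:R * v)%:E)%E) ->
  \forall n \near \oo, forall u, 0 <= u <= 2 ^+ n ->
    (P [set w | (a ^+ n < `|Z u w|)%R] <= (2^-1)%:E)%E.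
Proof.
move=> a1 a2 v0 statZ scZ Z0 EZ VZ.
have a0 : 0 < a by lra.
have i40 : 0 < 4^-1 :> R by rewrite invr_gt0.
have [M [_ tailM]] := uniform_tail_unit _ Z _ i40 scZ.
pose K := 2 * (`|M| + 1); have K0 : 0 < K.
  by rewrite mulr_gt0// ltr_wpDl.
have ia : `|a^-1| < 1 by rewrite gtr0_norm ?invr_gt0// invf_lt1.
have q1 : `|2 / a ^+ 2| < 1.
  by rewrite gtr0_norm ?divr_gt0 ?exprn_gt0// ltr_pdivrMr ?exprn_gt0// mul1r.
(* Chebyshev at level a^n / 2 gives 4 v (2 / a^2)^n, to be made at most 1/4; v + 1 replaces v, which
   may be 0. *)
have D0 : 0 < (16 * (v + 1))^-1 by rewrite invr_gt0 mulr_gt0// ltr_wpDl.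
near=> n.
have an0 : 0 < a ^+ n by rewrite exprn_gt0.
have anK : M < a ^+ n / 2.
  have : a^-1 ^+ n < K^-1.
    rewrite -[ltLHS]ger0_norm ?exprn_ge0 ?invr_ge0 ?(ltW a0)//.
    rewrite -[X in `|X|]subr0 distrC; near: n.
    by apply: cvgr_dist_lt (cvg_expr ia) _ _; rewrite invr_gt0.
  rewrite exprVn ltf_pV2 ?posrE// /K => KM.
  by have := ler_norm M; lra.
have qn : 4 * (2 ^+ n * v) / (a ^+ n) ^+ 2 <= 4^-1.
  have : (2 / a ^+ 2) ^+ n < (16 * (v + 1))^-1.
    rewrite -[ltLHS]ger0_norm ?exprn_ge0 ?divr_ge0 ?exprn_ge0 ?(ltW a0)//.
    rewrite -[X in `|X|]subr0 distrC; near: n.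
    by apply: cvgr_dist_lt (cvg_expr q1) _ _.
  rewrite expr_div_n exprAC; set q := _ / _ => qD.
  have q0 : 0 <= q by rewrite divr_ge0 ?exprn_ge0 ?(ltW a0).
  have : q * (16 * (v + 1)) < 1.
    by rewrite -ltr_pdivlMr ?div1r// mulr_gt0// ltr_wpDl.
  have -> : 4 * (2 ^+ n * v) / a ^+ 2 ^+ n = 4 * (q * v).
    by rewrite /q !mulrA mulrAC.
  lra.
move=> u /andP[u0 un]; pose k := truncn u.
have /andP[ku uk] := truncn_itv u0.
have -> : [set w | a ^+ n < `|Z u w|] =
    [set w | a ^+ n / 2 + a ^+ n / 2 < `|Z k%:R w + (Z u w - Z k%:R w)|].
  by apply/seteqP; split => w /=; rewrite -splitr [_ + (_ - _)]addrC subrK.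
apply: (le_trans (norm_tailD _ _ _ _ _ _ _)) => //.
  exact: measurable_funB.
have -> : (2^-1)%:E = (4^-1)%:E + (4^-1)%:E :> \bar R.
  by rewrite -EFinD; congr EFin; lra.
apply: leeD.
  have an20 : 0 < a ^+ n / 2 by rewrite divr_gt0.
  apply: (le_trans (tail_nat _ v _ _ an20 (EZ k) (VZ k))).
  rewrite lee_fin; apply: le_trans qn.
  rewrite [leLHS](_ : _ = 4 * (k%:R * v) / (a ^+ n) ^+ 2); last first.
    by field; rewrite gt_eqF.
  rewrite ler_pM2r ?invr_gt0 ?exprn_gt0// ler_pM2l// ler_wpM2r//.
  exact: le_trans un.
have uk0 : 0 <= u - k%:R by rewrite subr_ge0.
have uk1 : 0 <= u - k%:R <= 1 by rewrite uk0/= lerBlDl natr1 ltW.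
have := statZ k%:R (u - k%:R) (ler0n _ _) uk0 [set x | a ^+ n / 2 < `|x|].
move=> /(_ (measurable_norm_gt _ _ id _ (@measurable_id _ _ _))).
rewrite /= [_ + (_ - _)]addrC subrK => ->.
apply: le_trans (tailM _ anK _ uk1).
by under eq_set do rewrite Z0 subr0.
Unshelve. all: by end_near. Qed.

End DyadicGrowth.

(** * Almost sure bounds along dyadic grids *)

Section AlmostSureGrowth.
Context {disp : measure_display} {T : measurableType disp} {R : realType}.
Variable P : probability T R.

Lemma measurable_dyadic_exceedance (Z : R -> {RV P >-> R}) c n m :
  measurable (dyadic_exceedance P Z c n m).
Proof. by apply: bigsetU_measurable => k _; exact: measurable_norm_gt. Qed.

Lemma dyadic_exceedanceP (Z : R -> {RV P >-> R}) c n m w :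
  dyadic_exceedance P Z c n m w <->
  exists2 k, (k <= 2 ^ m)%N & 2 * c < `|Z (dyadic n m k) w|.
Proof.
rewrite /dyadic_exceedance.
rewrite -(bigcup_mkord _ (fun k => [set w | 2 * c < `|Z (dyadic n m k) w|])).
by split => -[k kn Zk]; exists k.
Qed.

Lemma dyadic_double n m k : dyadic n m.+1 (2 * k) = dyadic n m k :> R.
Proof.
by rewrite /dyadic exprS natrM; field; rewrite expf_neq0// pnatr_eq0.
Qed.

Lemma nondecreasing_dyadic_exceedance (Z : R -> {RV P >-> R}) c n :
  nondecreasing_seq (dyadic_exceedance P Z c n).
Proof.
apply/nondecreasing_seqP => m; apply/subsetPset => w.
move=> /dyadic_exceedanceP[k km Zk]; apply/dyadic_exceedanceP.
by exists (2 * k)%N; rewrite ?dyadic_double// expnS leq_mul2l.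
Qed.

(** By stationarity the increment from a grid point to 2^n has the law of [Z] at a time in [0, 2^n],
    so [tail] is what Ottaviani's inequality asks for. The bound is the same for all [m]. *)
Lemma dyadic_exceedance_le (Z : R -> {RV P >-> R}) (c : R) n m :
  independent_increments P Z -> stationary_increments P Z ->
  (forall w, Z 0 w = 0) ->
  (forall u, 0 <= u <= 2 ^+ n ->
    (P [set w | (c < `|Z u w|)%R] <= (2^-1)%:E)%E) ->
  (P (dyadic_exceedance P Z c n m) <=
   2%:E * P [set w | (c < `|Z (2 ^+ n)%R w|)%R])%E.
Proof.
move=> indZ statZ Z0 tail.
have h0 : 0 < 2 ^+ n / 2 ^+ m :> R by rewrite divr_gt0 ?exprn_gt0.
have dN : dyadic n m (2 ^ m) = 2 ^+ n :> R.
  by rewrite /dyadic natrX mulrC divfK// expf_neq0// pnatr_eq0.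
have dnd i j : (i <= j)%N -> dyadic n m i <= dyadic n m j :> R.
  by move=> ij; rewrite ler_pM2r// ler_nat.
have d0 : dyadic n m 0 = 0 :> R by rewrite /dyadic mul0r.
rewrite /dyadic_exceedance -[in X in (_ <= X)%E]dN.
apply: (ottaviani P Z (dyadic n m) (2 ^ m) c indZ).
- by rewrite d0.
- by move=> i; exact: dnd.
- by move=> w; rewrite d0.
- move=> k kN; rewrite dN.
  have dk0 : 0 <= dyadic n m k :> R by rewrite -d0 dnd.
  have dk1 : dyadic n m k <= 2 ^+ n :> R by rewrite -dN dnd.
  have u0 : 0 <= 2 ^+ n - dyadic n m k :> R by rewrite subr_ge0.
  have := statZ _ _ dk0 u0 [set x | c < `|x|].
  move=> /(_ (measurable_norm_gt _ _ id _ (@measurable_id _ _ _))).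
  rewrite /= [_ + (_ - _)]addrC subrK => ->.
  apply: le_trans (tail (2 ^+ n - dyadic n m k) _).
    by under eq_set do rewrite Z0 subr0.
  by rewrite u0/= gerBl.
Qed.

Lemma geometric_eseries_lty (C q : R) : 0 <= C -> 0 <= q -> q < 1 ->
  (\sum_(0 <= n <oo) (C * q ^+ n)%:E < +oo)%E.
Proof.
move=> C0 q0 q1; apply: (@le_lt_trans _ _ (C / (1 - q))%:E); last exact: ltry.
apply: lime_le.
  by apply: is_cvg_nneseries => n _ _; rewrite lee_fin mulr_ge0// exprn_ge0.
apply: nearW => n; rewrite sumEFin lee_fin.
have -> : \sum_(0 <= i < n) C * q ^+ i = series (geometric C q) n by [].
rewrite geometric_seriesE ?lt_eqF//= ler_pM2r ?invr_gt0 ?subr_gt0//.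
by rewrite ler_piMr// gerBl exprn_ge0.
Qed.

Lemma dyadic_exceedance_ae (Z : R -> {RV P >-> R}) (v a : R) :
  1 < a -> 2 < a ^+ 2 -> 0 <= v ->
  independent_increments P Z -> stationary_increments P Z ->
  stochastically_continuous P Z -> (forall w, Z 0 w = 0) ->
  (forall n : nat, ('E_P[Z n%:R%R] = 0)%E) ->
  (forall n : nat, ('V_P[Z n%:R%R] = (n%:R * v)%:E)%E) ->
  {ae P, forall w, exists n0, forall n, (n0 <= n)%N ->
    forall m k, (k <= 2 ^ m)%N -> `|Z (dyadic n m k) w| <= 2 * a ^+ n}.
Proof.
move=> a1 a2 v0 indZ statZ scZ Z0 EZ VZ.
have a0 : 0 < a by lra.
have [n0 _ tail] := tail_half P Z v a a1 a2 v0 statZ scZ Z0 EZ VZ.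
pose U n := \bigcup_m dyadic_exceedance P Z (a ^+ n) n m.
have mU n : measurable (U n).
  by apply: bigcup_measurable => m _; exact: measurable_dyadic_exceedance.
pose q := 2 / a ^+ 2.
have q0 : 0 <= q by rewrite divr_ge0 ?exprn_ge0 ?(ltW a0).
have q1 : q < 1 by rewrite ltr_pdivrMr ?exprn_gt0// mul1r.
have PU n : (n0 <= n)%N -> (P (U n) <= (2 * v * q ^+ n)%:E)%E.
  move=> n0n.
  (* The grids are nested, so continuity from below carries the bound to the union over all
     levels. *)
  have cvU : P (dyadic_exceedance P Z (a ^+ n) n m) @[m --> \oo] --> P (U n).
    apply: nondecreasing_cvg_mu; last 2 first.
    - exact: mU.
    - exact: nondecreasing_dyadic_exceedance.
    - by move=> m; exact: measurable_dyadic_exceedance.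
  apply: cvge_le cvU; apply: nearW => m.
  apply: (le_trans (dyadic_exceedance_le _ _ _ _ indZ statZ Z0 (tail n n0n))).
  have an0 : 0 < a ^+ n by rewrite exprn_gt0.
  have := tail_nat P Z v (a ^+ n) (2 ^ n) an0 (EZ _) (VZ _).
  rewrite natrX => Pn.
  apply: (le_trans (lee_wpmul2l _ Pn)); first by rewrite lee_fin.
  rewrite -EFinM lee_fin le_eqVlt; apply/orP; left; apply/eqP.
  by rewrite /q expr_div_n [(a ^+ 2) ^+ n]exprAC; ring.
(* The shift by [n0] discards the indices at which [PU] gives no bound. *)
have PF : (P (lim_sup_set (fun n => U (n + n0)%N)) = 0)%E.
  apply: lim_sup_set_cvg0 => //.
  apply: (le_lt_trans _ (geometric_eseries_lty (2 * v) q _ q0 q1)); last first.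
    by rewrite mulr_ge0.
  apply: lee_nneseries => // n _.
  apply: (le_trans (PU _ (leq_addl _ _))); rewrite lee_fin.
  rewrite ler_wpM2l ?mulr_ge0// exprD ler_piMr ?exprn_ge0//.
  by rewrite exprn_ile1// ltW.
exists (lim_sup_set (fun n => U (n + n0)%N)); split=> //.
  apply: bigcap_measurable => // n _.
  by apply: bigcup_measurable.
move=> w /= nw; apply: contrapT => nF; apply: nw.
have /existsNP[n H] : ~ forall n, (\bigcup_(j >= n) U (j + n0)%N) w.
  by move=> h; apply: nF => n _; exact: h.
exists (n + n0)%N => j nj m k km; rewrite leNgt; apply/negP => Zk.
have n0j : (n0 <= j)%N by exact: leq_trans (leq_addl _ _) nj.
apply: H; exists (j - n0)%N; first by rewrite /= leq_subRL// addnC.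
rewrite subnK//; exists m => //; apply/dyadic_exceedanceP.
by exists k.
Qed.

End AlmostSureGrowth.

(** If |x s| > 2 a^n with a = 2^beta, right continuity propagates this to an interval to the right
    of s, which contains a point of every fine enough grid. *)
Lemma dyadic_growth {R : realType} (x : R -> R) (beta : R) (n0 : nat) :
  0 < beta -> (forall s, 0 <= s -> x u @[u --> s^'+] --> x s) ->
  (forall n, (n0 <= n)%N -> forall m k, (k <= 2 ^ m)%N ->
    `|x (dyadic n m k)| <= 2 * (2 `^ beta) ^+ n) ->
  exists2 C, 0 <= C & forall s, 0 <= s -> `|x s| <= C * maxr 1 s `^ beta.
Proof.
move=> b0 rcx xd; set a := 2 `^ beta in xd *.
have a0 : 0 < a by rewrite powR_gt0.
have below n s : (n0 <= n)%N -> 0 <= s -> s < 2 ^+ n -> `|x s| <= 2 * a ^+ n.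
  move=> n0n s0 sn; rewrite leNgt; apply/negP => xs.
  have := @cvgr_gt _ _ _ _ _ _ (cvg_norm (rcx s s0)) _ xs.
  rewrite /at_right -nbhs_nearE => -[delta /= delta0 near_s].
  have n20 : 0 < 2 ^+ n :> R by rewrite exprn_gt0.
  pose m := truncn (2 ^+ n / delta).
  pose h : R := 2 ^+ n / 2 ^+ m.
  have h0 : 0 < h by rewrite divr_gt0 ?exprn_gt0.
  have hd : h < delta.
    rewrite /h ltr_pdivrMr ?exprn_gt0// mulrC -ltr_pdivrMr//.
    rewrite (lt_le_trans (truncnS_gt (2 ^+ n / delta)))// -[leRHS]natrX ler_nat.
    exact: ltn_expl.
  have sh0 : 0 <= s / h by rewrite divr_ge0// ltW.
  have /andP[ks sk] := truncn_itv sh0.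
  (* As s < 2^n is strict, the first grid point to the right of s still has an index at most 2^m. *)
  have km : (truncn (s / h) < 2 ^ m)%N.
    rewrite -(ltr_nat R) (le_lt_trans ks)// ltr_pdivrMr// /h natrX.
    by rewrite mulrC divfK// expf_neq0// pnatr_eq0.
  have := xd n n0n m (truncn (s / h)).+1 km; rewrite leNgt => /negP; apply.
  rewrite ler_pdivlMr// in ks; rewrite ltr_pdivrMr// in sk.
  apply: near_s; last exact: sk.
  rewrite /dyadic /= -/h distrC ger0_norm ?subr_ge0 ?(ltW sk)//.
  by move: sk ks; rewrite -natr1 mulrDl mul1r; lra.
(* If 2^k <= max(1, s) < 2^(k + 1), the bound at scale n0 + k + 1 is 2 a^(n0 + 1) (2^k)^beta. *)
exists (2 * a ^+ n0.+1); first by rewrite mulr_ge0// exprn_ge0// ltW.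
move=> s s0; set S := maxr 1 s.
have S1 : 1 <= S by rewrite le_max lexx.
have S0 : 0 <= S by lra.
have sS : s <= S by rewrite le_max lexx orbT.
have tS : (0 < truncn S)%N by rewrite truncn_gt0.
have /andP[kS Sk] := trunc_log_bounds (isT : 1 < 2)%N tS.
set k := trunc_log 2 (truncn S) in kS Sk.
have /andP[tS1 tS2] := truncn_itv S0.
have kS' : 2 ^+ k <= S.
  by apply: le_trans tS1; rewrite -natrX ler_nat.
have Sk' : S < 2 ^+ k.+1.
  by apply: (lt_le_trans tS2); rewrite -natrX ler_nat.
have sn : s < 2 ^+ (n0 + k.+1).
  rewrite (le_lt_trans sS)// (lt_le_trans Sk')// exprD ler_peMl ?exprn_ge0//.
  by rewrite exprn_ege1// ler1n.
apply: (le_trans (below (n0 + k.+1)%N s (leq_addr _ _) s0 sn)).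
rewrite addnS -addSn exprD mulrA ler_pM2l ?mulr_gt0 ?exprn_gt0//.
rewrite /a -powR_mulrn ?powR_ge0// -powRrM mulrC powRrM powR_mulrn//.
by apply: ge0_ler_powR; rewrite ?nnegrE ?exprn_ge0// ltW.
Qed.

(** * Growth of one-sided and two-sided processes *)

Section LevyGrowth.
Context {disp : measure_display} {T : measurableType disp} {R : realType}.
Variable P : probability T R.

Lemma levy_growth (X : R -> {RV P >-> R}) (beta : R) :
  2^-1 < beta -> levy_process P X -> ('E_P[X 1%R] = 0)%E ->
  (X 1 : T -> R) \in Lfun P 2%:E ->
  {ae P, forall w, exists2 C, 0 <= C &
    forall s, 0 <= s -> `|X s w| <= C * maxr 1 s `^ beta}.
Proof.
move=> b12 [X0 indX statX scX cadX] EX X2.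
have b0 : 0 < beta by rewrite (lt_trans _ b12)// invr_gt0.
(* [X 0] vanishes only almost surely; subtracting it keeps all increments and makes the process
   start at 0 everywhere. *)
pose Z t : {RV P >-> R} := X t \- X 0.
have ZB s t w : Z s w - Z t w = X s w - X t w by rewrite /Z/=; ring.
have Z0 w : Z 0 w = 0 by rewrite /Z/= subrr.
have indZ : independent_increments P Z.
  move=> n t t0 nd; rewrite (_ : (fun _ _ => _) =
    (fun (i : 'I_n) w => X (t i.+1) w - X (t i) w)); first exact: indX.
  by apply/funext => i; apply/funext => w; exact: ZB.
have statZ : stationary_increments P Z.
  move=> s t s0 t0 B mB; have := statX s t s0 t0 B mB.
  by under [in X in X = _ -> _]eq_set do rewrite -ZB;
     under [in X in _ = X -> _]eq_set do rewrite -ZB.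
have scZ : stochastically_continuous P Z.
  move=> t e t0 e0; have := scX t e t0 e0.
  rewrite (_ : (fun s => P [set w | e < `|Z s w - Z t w|]) =
    (fun s => P [set w | e < `|X s w - X t w|]))//.
  by apply/funext => s; congr (P _); apply/seteqP; split => w /=; rewrite ZB.
have Pfin : P setT \is a fin_num := fin_num_measure P _ measurableT.
have aeZ : {ae P, forall w, Z 1 w = X 1 w}.
  by apply: filterS X0 => w Xw; rewrite /Z/= Xw subr0.
have EZ2 : ('E_P[(fun w => Z 1 w ^+ 2)%R] = 'E_P[(fun w => X 1 w ^+ 2)%R])%E.
  rewrite unlock; apply: ae_eq_integral => //.
  - by apply/measurable_EFinP; exact: measurable_funX.
  - by apply/measurable_EFinP; exact: measurable_funX.
  - by apply: filterS aeZ => w /= ->.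
have Z2 : (Z 1 : T -> R) \in Lfun P 2%:E.
  apply: Lfun2_sqr_lty; first exact: measurable_funPT.
  rewrite EZ2 unlock.
  exact: (integrable_lty measurableT (Lfun2_integrable_sqr X2)).
have EZ : ('E_P[Z 1%R] = 0)%E.
  rewrite -EX unlock; apply: ae_eq_integral => //.
  - by apply/measurable_EFinP; exact: measurable_funPT.
  - by apply/measurable_EFinP; exact: measurable_funPT.
  - by apply: filterS aeZ => w /= ->.
pose v := fine 'V_P[Z 1%R].
have vE : ('V_P[Z 1%R] = v%:E)%E by rewrite fineK// variance_fin_num.
have v0 : 0 <= v by rewrite fine_ge0// variance_ge0.
have momZ := variance_nat P Z indZ statZ Z0 Z2 EZ.
have EZn n : ('E_P[Z n%:R%R] = 0)%E by case: (momZ n).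
have VZn n : ('V_P[Z n%:R%R] = (n%:R * v)%:E)%E.
  by case: (momZ n) => _ _ ->; rewrite vE.
have a1 : 1 < 2 `^ beta :> R.
  have : 1 `^ beta < 2 `^ beta :> R.
    by apply: gt0_ltr_powR; rewrite ?nnegrE ?ltr1n.
  by rewrite powR1.
have a2 : 2 < (2 `^ beta) ^+ 2 :> R.
  rewrite -powR_mulrn ?powR_ge0// -powRrM -[ltLHS]powRr1//.
  rewrite /powR pnatr_eq0/= ltr_expR ltr_pM2r ?ln_gt0 ?ltr1n//.
  by move: b12; lra.
have aeD := dyadic_exceedance_ae P Z v _ a1 a2 v0 indZ statZ scZ Z0 EZn VZn.
apply: filterS (filterI X0 (filterI cadX aeD)) => w [Xw [[rcw _] [n0 Dw]]].
apply: (dyadic_growth (X ^~ w) beta n0 b0 rcw) => n n0n m k km.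
by have := Dw n n0n m k km; rewrite /Z/= Xw subr0.
Qed.

End LevyGrowth.

Section TwoSidedGrowth.
Context {disp : measure_display} {T : measurableType disp} {R : realType}.
Variable P : probability T R.

(** The moments of L 1 are those of L1 1, and pass to L2 1 by equality in law. At s < 0 the value of
    [L] is the left limit of [L2] at - s, so the bound on [L2] at times u < - s passes to the
    limit. *)
Lemma driving_levy_growth (L : R -> {RV P >-> R}) (beta : R) :
  2^-1 < beta -> driving_levy_process P L ->
  {ae P, forall w, exists2 C, 0 <= C &
    forall s, s < 0 -> `|L s w| <= C * maxr 1 (- s) `^ beta}.
Proof.
move=> b12 [[L1 [L2 [levy1 levy2 law12 _ LE]]] EL L2oo _].
have b0 : 0 < beta by rewrite (lt_trans _ b12)// invr_gt0.
have L1E t : 0 <= t -> (L t : T -> R) = L1 t.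
  by move=> t0; apply/funext => w; rewrite LE /two_sided t0.
have law B : measurable B -> P (L1 1 @^-1` B) = P (L2 1 @^-1` B).
  move=> mB; have := law12 1%N (fun=> 1) (fun=> B) (fun=> ler01) (fun=> mB).
  have setE (X : T -> R) : [set w | forall _ : 'I_1, B (X w)] = X @^-1` B.
    by apply/seteqP; split => w /= h; [exact: h ord0|].
  by rewrite !setE.
have Pfin : P setT \is a fin_num := fin_num_measure P _ measurableT.
have L12 : (L1 1 : T -> R) \in Lfun P 2%:E.
  apply: Lfun2_sqr_lty; first exact: measurable_funPT.
  by rewrite -(L1E 1 ler01).
have L22 : (L2 1 : T -> R) \in Lfun P 2%:E.
  apply: Lfun2_sqr_lty; first exact: measurable_funPT.
  by rewrite -(eq_law_sqr P _ _ law) -(L1E 1 ler01).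
have EL2 : ('E_P[L2 1%R] = 0)%E.
  rewrite -(eq_law_expectation P _ _ law) ?(Lfun_subset12 Pfin)//.
  by rewrite -(L1E 1 ler01) EL.
have gr := levy_growth P L2 beta b12 levy2 EL2 L22.
have [_ _ _ _ cad] := levy2.
apply: filterS (filterI cad gr) => w [[_ llw] [C C0 Cw]].
exists C => // s s0; rewrite LE /two_sided (lt_geF s0).
have ns0 : 0 < - s by rewrite oppr_gt0.
have /cvg_norm := llw (- s) ns0.
move=> /cvgr_to_le; apply; near=> u.
have us : u < - s by near: u; exact: nbhs_left_lt.
have u0 : 0 < u by near: u; exact: nbhs_left_gt.
apply: (le_trans (Cw _ (ltW u0))); rewrite ler_wpM2l//.
apply: ge0_ler_powR; rewrite ?nnegrE ?(ltW b0) ?ge_max ?le_max ?ler01//.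
by rewrite lexx/= (ltW us) orbT.
Unshelve. all: by end_near. Qed.

End TwoSidedGrowth.

Lemma powR_ninfty_cvg0 {R : realType} (f : R -> R) (K p : R) : 0 < p ->
  (\forall t \near -oo, `|f t| <= K * (- t) `^ (- p)) ->
  f t @[t --> -oo] --> (0 : R).
Proof.
move=> p0 fK; apply/cvgrPdist_le => e e0.
near=> t; rewrite sub0r normrN.
have t0 : t < 0 by near: t; apply: nbhs_ninfty_lt; rewrite num_real.
have nt0 : 0 < - t by rewrite oppr_gt0.
have tK : ((`|K| + 1) / e) `^ p^-1 <= - t.
  by rewrite lerNr; near: t; apply: nbhs_ninfty_le; rewrite num_real.
apply: (@le_trans _ _ (K * (- t) `^ (- p))); first by near: t.
have Ke0 : 0 < (`|K| + 1) / e by rewrite divr_gt0// ltr_wpDl.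
have : ((`|K| + 1) / e) <= (- t) `^ p.
  have -> : (`|K| + 1) / e = (((`|K| + 1) / e) `^ p^-1) `^ p.
    by rewrite -powRrM mulVf ?powRr1 ?(ltW Ke0)// gt_eqF.
  by apply: ge0_ler_powR; rewrite ?nnegrE ?powR_ge0 ?(ltW p0) ?(ltW nt0).
rewrite ler_pdivrMr// => h; rewrite powRN ler_pdivrMr ?powR_gt0// [leRHS]mulrC.
by apply: (le_trans _ h); rewrite (le_trans (ler_norm K))// lerDl.
Unshelve. all: by end_near. Qed.

Theorem theorem3p1 (disp : measure_display) (T : measurableType disp)
    (R : realType) (P : probability T R) (Pcomplete : measure_is_complete P)
    (d : R) (d_gt0 : 0 < d) (d_lt : d < 1 / 2)
    (L Ld : R -> {RV P >-> R}) (HLd : fractional_levy_process P d L Ld)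
    (alpha : R) (halpha : d + 1 / 2 < alpha) :
  {ae P, forall w, `|Ld t w| / `|t| `^ alpha @[t --> -oo] --> (0 : R)}.
Proof.
have [drivL _ path] := HLd.
(* The midpoint of 1/2 and min(1 - d, alpha - d); [d_lt] and [halpha] put both candidates for the
   minimum above 1/2. *)
have [beta [b12 bd ba]] : exists beta : R,
    [/\ 2^-1 < beta, d + beta < 1 & d + beta < alpha].
  have [le|lt] := leP (1 - d) (alpha - d).
    by exists ((2^-1 + (1 - d)) / 2); split; lra.
  by exists ((2^-1 + (alpha - d)) / 2); split; lra.
have b0 : 0 < beta by lra.
apply: filterS (filterI path (driving_levy_growth P L beta b12 drivL)).
move=> w [pathw [C C0 Cw]].
pose K := `|(Gamma d)^-1| * (C * (2 / (1 - d - beta) + 3 / d)).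
have p0 : 0 < alpha - (d + beta) by lra.
apply: (powR_ninfty_cvg0 _ K _ p0).
near=> t; have t1 : t <= -1.
  by near: t; apply: nbhs_ninfty_le; rewrite num_real.
have nt0 : 0 < - t by lra.
have [v gv ->] := pathw t.
have vC := fractional_integral_le d beta C t (L ^~ w) v d_gt0 b0 bd C0 t1 Cw gv.
have tE : `|t| = - t by rewrite ltr0_norm//; lra.
rewrite tE [leLHS]ger0_norm ?divr_ge0 ?powR_ge0//.
rewrite opprB powRB; last by apply/implyP => _; rewrite gt_eqF.
rewrite mulrA ler_pM2r ?invr_gt0 ?powR_gt0//.
by rewrite normrM /K -mulrA ler_wpM2l.
Unshelve. all: by end_near. Qed.
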